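(* Let $k_1\neq k_2$ in $\{1,\dots,K\}$, $1\le l_1\le L_{k_1}$ and $1\le l_2\le L_{k_2}$. Then, as $\nu\to\infty$, $$\mathbb{E}\, T_{(k_1,l_1),(k_2,l_2)}(\nu)\;\sim\;\frac{1}{L_{k_1}} f_{k_1}(\nu)^{L_{k_1}-1}+\frac{1}{L_{k_2} f_{k_2}(\nu)}\sum_{k\in K_*} f_k(\nu)^{L_k}.$$
   Context: Let $K, L_1,\dots,L_K$ be positive integers and let $f_1,\dots,f_K:\mathbb{R}_+\to\mathbb{R}_+$ be monotone functions with $\lim_{\nu\to\infty} f_k(\nu)=\infty$ for every $k$. Put $\mathcal{B}_k=\{(k,l):1\le l\le L_k\}$ and $\Omega=\{0\}\cup\bigcup_{k=1}^K\mathcal{B}_k$. For each $\nu$, $\{X(t)\}_{t\ge 0}$ is the continuous-time Markov process on $\Omega$ with transition rates $q(0,(k,1))=L_k f_k(\nu)$, $q((k,1),0)=1$, $q((k,l),(k,l+1))=(L_k-l)f_k(\nu)$ for $1\le l\le L_k-1$, $q((k,l),(k,l-1))=l$ for $2\le l\le L_k$ (for $k=1,\dots,K$), all other off-diagonal rates being $0$. The transition time is $T_{(k_1,l_1),(k_2,l_2)}(\nu)=\inf\{t>0: X(t)=(k_2,l_2)\}$ for the process started at $X(0)=(k_1,l_1)$. For fixed $k_2$ and $k\ne k_2$ define $\gamma_k=\lim_{\nu\to\infty}\frac{f_k(\nu)^{L_k}}{\sum_{j\ne k_2} f_j(\nu)^{L_j}}$; all these limits are assumed to exist. The set of dominant branches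 is $K_*=\{k\ne k_2:\gamma_k>0\}$. The notation $f(\nu)\sim g(\nu)$ means $\lim_{\nu\to\infty} f(\nu)/g(\nu)=1$. *)

(* Defs.v *)
From HB Require Import structures.
From mathcomp Require Import all_boot all_order all_algebra.
From mathcomp Require Import all_classical all_reals all_analysis.
Import Order.TTheory GRing.Theory Num.Theory.
Import numFieldNormedType.Exports.

Set Implicit Arguments.
Unset Strict Implicit.
Unset Printing Implicit Defensive.

Local Open Scope classical_set_scope.
Local Open Scope ring_scope.

(** Continuous-time Markov processes on a finite state space *)

(* [q x y] is only meaningful for [x != y]: the conditions [tf_sum] and
   [tf_rate] force [(p h x x - 1) / h] to tend to minus the total exit rate. *)
Record transition_function (R : realType) (S : finType)
    (q : S -> S -> R) (p : R -> S -> S -> R) : Prop := TransitionFunction {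
  tf_ge0 : forall (t : R) x y, 0 <= t -> 0 <= p t x y;
  tf_sum : forall (t : R) x, 0 <= t -> \sum_y p t x y = 1;
  tf_0 : forall x y, p 0 x y = (x == y)%:R;
  tf_chapman_kolmogorov : forall (s t : R) x y, 0 <= s -> 0 <= t ->
    p (s + t) x y = \sum_z p s x z * p t z y;
  tf_rate : forall x y, x != y -> h^-1 * p h x y @[h --> 0^'+] --> q x y
}.

(* The Markov property is written multiplicatively, so that nothing is
   required when the conditioning event has probability zero. *)
Record markov_process (R : realType) (S : finType) (q : S -> S -> R) (x0 : S)
    (d : measure_display) (T : measurableType d) (P : probability T R)
    (X : R -> T -> S) : Prop := MarkovProcess {
  mp_measurable : forall (t : R) x, 0 <= t -> measurable [set w | X t w = x];
  mp_right_continuous : forall w (t : R), 0 <= t ->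
    \forall s \near t^'+, X s w = X t w;
  mp_start : P [set w | X 0 w = x0] = 1%E;
  mp_markov : exists2 p, transition_function q p &
    forall (n : nat) (t : nat -> R) (x : nat -> S),
      0 <= t 0%N -> (forall m, (m <= n)%N -> t m <= t m.+1) ->
      P [set w | forall m, (m <= n.+1)%N -> X (t m) w = x m] =
      (P [set w | forall m, (m <= n)%N -> X (t m) w = x m] *
       (p (t n.+1 - t n) (x n) (x n.+1))%:E)%E
}.

(* Extended-real valued: it is [+oo] when [y] is never reached. *)
Definition transition_time (R : realType) (S : finType) (T : Type)
    (X : R -> T -> S) (y : S) (w : T) : \bar R :=
  ereal_inf [set t%:E | t in [set t : R | 0 < t /\ X t w = y]].

(** The state space [{0} U B_1 U ... U B_K] and its rates *)

(* [None] is the centre 0.  Branches and positions are numbered from 0 in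
   ['I_K] and ['I_(L k)]; [level] is the position numbered from 1. *)
Definition star_state (K : nat) (L : 'I_K -> nat) : finType :=
  option {k : 'I_K & 'I_(L k)}.

Definition star_node (K : nat) (L : 'I_K -> nat) (k : 'I_K) (l : 'I_(L k)) :
    star_state L :=
  Some (Tagged (fun k => 'I_(L k)) l).

Definition branch (K : nat) (L : 'I_K -> nat) (u : {k : 'I_K & 'I_(L k)}) :
  'I_K := tag u.

Definition level (K : nat) (L : 'I_K -> nat) (u : {k : 'I_K & 'I_(L k)}) :
  nat := (tagged u : nat).+1.

Definition star_rate (R : realType) (K : nat) (L : 'I_K -> nat) (a : 'I_K -> R)
    (x y : star_state L) : R :=
  match x, y with
  | None, None => 0
  | None, Some v =>
      if level v == 1%N then (L (branch v))%:R * a (branch v) else 0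
  | Some u, None => if level u == 1%N then 1 else 0
  | Some u, Some v =>
      if branch u != branch v then 0
      else if level v == (level u).+1 then
        (L (branch u) - level u)%:R * a (branch u)
      else if level u == (level v).+1 then (level u)%:R
      else 0
  end.

(** Asymptotics of the rate functions *)

Definition monotone_nneg (R : realType) (g : R -> R) : Prop :=
  (forall x y : R, 0 <= x -> x <= y -> g x <= g y) \/
  (forall x y : R, 0 <= x -> x <= y -> g y <= g x).

Definition branch_share (R : realType) (K : nat) (L : 'I_K -> nat)
    (f : 'I_K -> R -> R) (k2 k : 'I_K) (nu : R) : R :=
  f k nu ^+ L k / \sum_(j | j != k2) f j nu ^+ L j.

Definition gamma_lim (R : realType) (K : nat) (L : 'I_K -> nat)
    (f : 'I_K -> R -> R) (k2 k : 'I_K) : R :=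
  lim (branch_share L f k2 k nu @[nu --> +oo]).

Definition dominant (R : realType) (K : nat) (L : 'I_K -> nat)
    (f : 'I_K -> R -> R) (k2 : 'I_K) : {set 'I_K} :=
  [set k | (k != k2) && (0 < gamma_lim L f k2 k)]%SET.

(* The ratio is taken in the extended reals, so that an infinite value of the
   left-hand side is not collapsed to a finite one. *)
Definition equivalent_at_infinity (R : realType) (F : R -> \bar R)
    (g : R -> R) : Prop :=
  (F nu * ((g nu)^-1)%:E)%E @[nu --> +oo%R] --> 1%E.

(* Main.v *)
(* Any nonnegative [h] with [h y = 0] and [Q h = -1] off [y] is the mean hitting
   time of [y]: sampling the path at step [2^-n] gives a killed Markov chain
   along which the mean of [h] drops by [2^-n (1 + o(1))] times the survival
   probability, so the mean sampled hitting time tends to [h]; right-continuity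
   and dominated convergence pass to the continuous-time hitting time.

   On the star, which is a tree, [h] is a sum of mean one-edge passage times,
   each a quotient (stationary weight behind the edge) / (flow through it).
   As the rates blow up, only the step from level 1 of branch [k1] to the centre
   and the step from the centre to level 1 of branch [k2] matter. *)

Require Import Defs.
From HB Require Import structures.
From mathcomp Require Import all_boot all_order all_algebra.
From mathcomp Require Import all_classical all_reals all_analysis.
From mathcomp Require Import measurable_realfun ring lra zify.
Import Order.TTheory GRing.Theory Num.Theory.
Import numFieldNormedType.Exports.

Set Implicit Arguments.
Unset Strict Implicit.
Unset Printing Implicit Defensive.

Local Open Scope classical_set_scope.
Local Open Scope ring_scope.

(** * Hitting times of a path sampled on a grid *)

Definition avoids (R : realType) (S : finType) (T : Type) (X : R -> T -> S)
    (y : S) (del : R) (m : nat) (w : T) : bool :=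
  [forall j : 'I_m, X (j.+1%:R * del) w != y].

(** For positive [del] this is the first grid time at which the path is in [y], or [+oo] if there is
    none. Grid indices start at 1, in keeping with [0 < t] in [transition_time]; the series form
    turns the mean into a sum of survival probabilities. *)
Definition sampled_time (R : realType) (S : finType) (T : Type)
    (X : R -> T -> S) (y : S) (del : R) (w : T) : \bar R :=
  (\sum_(0 <= m <oo) (if avoids X y del m w then del else 0)%:E)%E.

Lemma sampled_time_le (R : realType) (S : finType) (T : Type)
    (X : R -> T -> S) (y : S) (del : R) (m : nat) (w : T) :
  0 <= del -> X (m.+1%:R * del) w = y ->
  (sampled_time X y del w <= (m.+1%:R * del)%:E)%E.
Proof.
move=> del0 Xy; rewrite /sampled_time.
have t0 k : (0 <= (if avoids X y del k w then del else 0)%:E)%E.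
  by rewrite lee_fin; case: ifP.
rewrite (@nneseries_split _ _ 0 m.+1)// add0n.
rewrite [X in (_ + X)%E]eseries0 ?adde0; last first.
  move=> k mk _; case: ifP => // /forallP/(_ (Ordinal mk)) /=.
  by rewrite Xy eqxx.
rewrite sumEFin lee_fin mulr_natl -[X in del *+ X]subn0 -sumr_const_nat.
by apply: ler_sum => i _; case: ifP.
Qed.

Lemma sampled_timeP (R : realType) (S : finType) (T : Type)
    (X : R -> T -> S) (y : S) (del : R) (w : T) : 0 < del ->
  (exists2 m : nat, X (m.+1%:R * del) w = y &
     sampled_time X y del w = (m.+1%:R * del)%:E) \/
  sampled_time X y del w = +oo%E.
Proof.
move=> del0; rewrite /sampled_time.
have t0 k : (0 <= (if avoids X y del k w then del else 0)%:E)%E.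
  by rewrite lee_fin; case: ifP => // _; exact: ltW.
have [hit|nohit] := pselect (exists m, X (m.+1%:R * del) w == y).
  left; case: (ex_minnP hit) => m /eqP Xm mmin; exists m => //.
  apply/eqP; rewrite eq_le sampled_time_le ?(ltW del0)//=.
  rewrite (@nneseries_split _ _ 0 m.+1)// add0n.
  rewrite -[leLHS]adde0; apply: leeD; last exact: nneseries_ge0.
  rewrite sumEFin lee_fin mulr_natl -[X in del *+ X]subn0 -sumr_const_nat.
  rewrite !big_mkord; apply: ler_sum => i _.
  case: ifP => // /negP[]; apply/forallP => j; apply/negP => Xj.
  by have := leq_ltn_trans (mmin _ Xj) (ltn_ord j); rewrite ltnNge -ltnS ltn_ord.
right.
rewrite (_ : (fun n => _) = fun n => (n%:R * del)%:E); last first.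
  apply/funext => n; rewrite sumEFin; congr EFin.
  rewrite mulr_natl -[X in del *+ X]subn0 -sumr_const_nat.
  apply: eq_bigr => i _; case: ifP => // /negP[]; apply/forallP => j.
  by apply/negP => Xj; apply: nohit; exists j.
apply: cvg_lim => //; apply/cvgeryP.
apply/cvgryPge => A; near=> n.
rewrite -ler_pdivrMr//; near: n.
exact: nbhs_infty_ger.
Unshelve. all: by end_near. Qed.

Lemma transition_time_le (R : realType) (S : finType) (T : Type)
    (X : R -> T -> S) (y : S) (w : T) (t : R) :
  0 < t -> X t w = y -> (transition_time X y w <= t%:E)%E.
Proof. by move=> t0 Xt; apply: ereal_inf_lbound; exists t. Qed.

Lemma transition_time_ge0 (R : realType) (S : finType) (T : Type)
    (X : R -> T -> S) (y : S) (w : T) : (0 <= transition_time X y w)%E.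
Proof. by apply: le_ereal_inf_tmp => _ [t [t0 _] <-]; rewrite lee_fin ltW. Qed.

Lemma sampled_time_ge0 (R : realType) (S : finType) (T : Type)
    (X : R -> T -> S) (y : S) (del : R) (w : T) : 0 <= del ->
  (0 <= sampled_time X y del w)%E.
Proof. by move=> ?; apply: nneseries_ge0 => k _ _; rewrite lee_fin; case: ifP. Qed.

Lemma transition_time_le_sampled (R : realType) (S : finType) (T : Type)
    (X : R -> T -> S) (y : S) (del : R) (w : T) : 0 < del ->
  (transition_time X y w <= sampled_time X y del w)%E.
Proof.
move=> del0; have [[m Xm ->]|->] := sampled_timeP X y w del0; last exact: leey.
by apply: transition_time_le => //; rewrite mulr_gt0.
Qed.

(** The coarse grid is contained in the fine one, so a visit seen on the former is also seen on the
    latter. This monotonicity later provides a dominating function. *)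
Lemma sampled_time_refine (R : realType) (S : finType) (T : Type)
    (X : R -> T -> S) (y : S) (del del' : R) (k : nat) (w : T) :
  0 < del' -> del = k.+1%:R * del' ->
  (sampled_time X y del' w <= sampled_time X y del w)%E.
Proof.
move=> del'0 delE; have del0 : 0 < del by rewrite delE mulr_gt0.
have [[m Xm ->]|->] := sampled_timeP X y w del0; last exact: leey.
have E : m.+1%:R * del = (m.+1 * k.+1).-1.+1%:R * del'.
  by rewrite delE mulrA -natrM prednK.
by rewrite E; apply: sampled_time_le; rewrite -?E// ltW.
Qed.

(* Right-continuity keeps the path at [y] on some [(t, t + e)], which every
   sufficiently fine grid meets. *)
Lemma sampled_time_cvg (R : realType) (S : finType) (T : Type)
    (X : R -> T -> S) (y : S) (w : T) (del : nat -> R) :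
  (forall t : R, 0 <= t -> \forall s \near t^'+, X s w = X t w) ->
  (forall n, 0 < del n) -> del n @[n --> \oo] --> 0 ->
  sampled_time X y (del n) w @[n --> \oo] --> transition_time X y w.
Proof.
move=> rc del0 delcvg.
have lb n := transition_time_le_sampled X y w (del0 n).
have : (0 <= transition_time X y w)%E by exact: transition_time_ge0.
case E: (transition_time X y w) => [r| |]// _; last first.
  rewrite (_ : (fun n => _) = fun=> +oo%E); first exact: cvg_cst.
  by apply/funext => n; apply/eqP; rewrite -leye_eq -E.
suff key (e : R) : 0 < e ->
    \forall n \near \oo, (sampled_time X y (del n) w <= (r + e)%:E)%E.
  apply/fine_cvgP; split.
    near=> n; have : (sampled_time X y (del n) w <= (r + 1)%:E)%E.
      by near: n; exact: key.
    have := lb n; rewrite E.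
    by case: (sampled_time X y (del n) w).
  apply/cvgrPdist_le => e e0; near=> n.
  have : (sampled_time X y (del n) w <= (r + e)%:E)%E by near: n; exact: key.
  have := lb n; rewrite E /=.
  case: (sampled_time X y (del n) w) => [s| |]//=.
  rewrite !lee_fin => rs se; rewrite distrC ger0_norm ?subr_ge0//.
  by rewrite lerBlDl.
move=> e0.
(* A visit at a time [t] within [e / 2] of the infimum leaves the other [e / 2] for the overshoot of
   the grid. *)
have [t [t0 Xt] tr] : exists2 t, 0 < t /\ X t w = y & t < r + e / 2.
  have : (transition_time X y w < (r + e / 2)%:E)%E.
    by rewrite E lte_fin ltrDl divr_gt0.
  by move=> /ereal_inf_lt[_ [t ? <-]]; rewrite lte_fin; exists t.
have /(_ t (ltW t0)) := rc; rewrite Xt => -[eta /= eta0 etaP].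
near=> n.
have dn : del n < Num.min eta (e / 2).
  near: n; have := @cvgr_lt _ _ _ _ _ _ delcvg; apply.
  by rewrite lt_min eta0 divr_gt0.
move: dn; rewrite lt_min => /andP[dn1 dn2].
(* [m.+1] is the first grid index strictly after [t]. It overshoots [t] by at most [del n], which is
   below both [eta] (the path is still at [y]) and [e / 2]. *)
set m := Num.trunc (t / del n).
have /andP[m1 m2] : m%:R <= t / del n < m.+1%:R.
  by apply: truncn_itv; rewrite divr_ge0 ?ltW.
have tm : t < m.+1%:R * del n by rewrite -ltr_pdivrMr.
have mt : m.+1%:R * del n <= t + del n.
  by rewrite -natr1 mulrDl mul1r lerD2r -ler_pdivlMr.
have Xm : X (m.+1%:R * del n) w = y.
  apply: etaP => //=; rewrite distrC ger0_norm ?subr_ge0 ?(ltW tm)//.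
  rewrite ltrBlDl; apply: le_lt_trans mt _; by rewrite ltrD2l.
apply: le_trans (sampled_time_le (ltW (del0 n)) Xm) _.
rewrite lee_fin (le_trans mt)// (splitr e) addrA lerD// ltW//.
Unshelve. all: by end_near. Qed.

(** * Finite-time events, the Markov property and killed chains *)

Lemma fine_measure_fiber_sum (R : realType) (d : measure_display)
    (T : measurableType d) (P : probability T R) (F : finType) (Y : T -> F)
    (B : set T) :
  (forall z, measurable [set w | Y w = z]) -> measurable B ->
  fine (P B) = \sum_z fine (P (B `&` [set w | Y w = z])).
Proof.
move=> mY mB.
have mBY z : measurable (B `&` [set w | Y w = z]) by exact: measurableI.
rewrite [X in fine (P X)](_ : B =
    \bigcup_(z in [set: F]) (B `&` [set w | Y w = z])); last first.
  by apply/seteqP; split => [w Bw|w [z _ []]]//; exists (Y w).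
rewrite measure_fin_bigcup//; first last.
- by move=> z z' _ _ [w [[_ <-] [_ <-]]].
- exact: finite_finset.
have -> : [set: F] = [set` index_enum F].
  by apply/seteqP; split => z //= _; rewrite mem_index_enum.
rewrite -(fsbig_seq _ _ (index_enum_uniq F)) sum_fine// => z _.
exact: fin_num_measure.
Qed.

Definition path_event (R : realType) (S : finType) (T : Type) (X : R -> T -> S)
    (t : nat -> R) (n : nat) (E : pred {ffun 'I_n.+1 -> S}) : set T :=
  [set w | E [ffun j : 'I_n.+1 => X (t j) w]].

Lemma measurable_path_event (R : realType) (S : finType) (d : measure_display)
    (T : measurableType d) (X : R -> T -> S) (t : nat -> R) (n : nat)
    (E : pred {ffun 'I_n.+1 -> S}) :
  (forall (s : R) x, 0 <= s -> measurable [set w | X s w = x]) ->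
  (forall j, 0 <= t j) -> measurable (path_event X t E).
Proof.
move=> mX t0.
have -> : path_event X t E = \bigcup_(x in [set x | E x])
    \bigcap_(j in [set: 'I_n.+1]) [set w | X (t j) w = x j].
  apply/seteqP; split => w /=; rewrite /path_event/=.
    move=> EY; exists [ffun j : 'I_n.+1 => X (t j) w] => //= j _ /=.
    by rewrite ffunE.
  move=> [x Ex Xx].
  by rewrite (_ : [ffun j => _] = x)//; apply/ffunP => j; rewrite ffunE Xx.
apply: fin_bigcup_measurable; first exact: finite_finset.
move=> x _; apply: fin_bigcap_measurable; first exact: finite_finset.
by move=> j _; exact: mX.
Qed.

(** The Markov assumption speaks of single trajectories. Both sides are split over the finitely many
    values of the path at the times [t 0] to [t n], and the assumption is applied to each trajectory
    on which [E] holds. *)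
Lemma markov_path_event (R : realType) (S : finType) (d : measure_display)
    (T : measurableType d) (P : probability T R) (X : R -> T -> S)
    (p : R -> S -> S -> R) (t : nat -> R) (n : nat)
    (E : pred {ffun 'I_n.+1 -> S}) (z : S) :
  (forall (s : R) x, 0 <= s -> measurable [set w | X s w = x]) ->
  (forall j, 0 <= t j) ->
  (forall x : nat -> S,
      P [set w | forall m, (m <= n.+1)%N -> X (t m) w = x m] =
      (P [set w | forall m, (m <= n)%N -> X (t m) w = x m] *
       (p (t n.+1 - t n) (x n) (x n.+1))%:E)%E) ->
  fine (P (path_event X t E `&` [set w | X (t n.+1) w = z])) =
  \sum_a fine (P (path_event X t E `&` [set w | X (t n) w = a])) *
    p (t n.+1 - t n) a z.
Proof.
move=> mX t0 mk.
have mE (F : pred {ffun 'I_n.+1 -> S}) : measurable (path_event X t F).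
  exact: measurable_path_event.
have mXt m a : measurable [set w | X (t m) w = a] by exact: mX.
pose Y w : {ffun 'I_n.+1 -> S} := [ffun j : 'I_n.+1 => X (t j) w].
have mY x : measurable [set w | Y w = x].
  have := mE (pred1 x); rewrite /path_event; congr measurable.
  by apply/seteqP; split => w /= /eqP.
rewrite (fine_measure_fiber_sum _ mY)//; last exact: measurableI.
transitivity (\sum_a \sum_x fine (P (path_event X t E `&`
    [set w | X (t n) w = a] `&` [set w | Y w = x])) * p (t n.+1 - t n) a z);
  last first.
  apply: eq_bigr => a _; rewrite -mulr_suml -(fine_measure_fiber_sum P mY)//.
  exact: measurableI.
rewrite exchange_big; apply: eq_bigr => x _ /=.
rewrite (bigD1 (x ord_max))//= [X in _ + X]big1 ?addr0; last first.
  move=> a ax; suff -> : path_event X t E `&` [set w | X (t n) w = a] `&`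
      [set w | Y w = x] = set0 by rewrite measure0 mul0r.
  apply/seteqP; split => // w [[_ /= Xa] Yx]; move: ax.
  by rewrite -Xa -Yx ffunE eqxx.
have [Ex|nEx] := boolP (E x); last first.
  have E0 B : path_event X t E `&` B `&` [set w | Y w = x] = set0.
    apply/seteqP; split => // w [[+ _]]; rewrite /path_event/= => + Yx.
    by rewrite -/(Y w) Yx (negbTE nEx).
  by rewrite !E0 measure0 mul0r.
(* The assumption takes sequences indexed by [nat], so [x] is continued by [z] after index [n]. *)
pose x' m := if (m <= n)%N then x (inord m) else z.
have Yx' w : Y w = x <-> forall m, (m <= n)%N -> X (t m) w = x' m.
  split => [Yx m mn|H]; first by rewrite /x' mn -Yx ffunE inordK.
  apply/ffunP => j; rewrite ffunE H -1?ltnS// /x' -ltnS ltn_ord.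
  by rewrite inord_val.
have x'n : x' n = x ord_max.
  by rewrite /x' leqnn; congr (x _); apply: val_inj; rewrite /= inordK.
have x'n1 : x' n.+1 = z by rewrite /x' ltnn.
have := mk x'; rewrite x'n x'n1.
have -> : [set w | forall m, (m <= n.+1)%N -> X (t m) w = x' m] =
    path_event X t E `&` [set w | X (t n.+1) w = z] `&` [set w | Y w = x].
  apply/seteqP; split => w /=.
    move=> H; have Yx : Y w = x by apply/Yx' => m mn; rewrite H// ltnW.
    by split => //; split; rewrite /path_event/= -?/(Y w) ?Yx// H.
  move=> [[_ Xz] /Yx' H] m; rewrite leq_eqVlt => /predU1P[->|]; last exact: H.
  by rewrite Xz x'n1.
have -> : [set w | forall m, (m <= n)%N -> X (t m) w = x' m] =
    path_event X t E `&` [set w | X (t n) w = x ord_max] `&` [set w | Y w = x].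
  apply/seteqP; split => w /=.
    move=> /Yx' Yx; split => //; split.
      by rewrite /path_event/= -/(Y w) Yx.
    by rewrite -Yx ffunE.
  by move=> [_ /Yx'].
move=> ->; rewrite fineM ?fin_num_measure//=.
by apply: measurableI => //; exact: measurableI.
Qed.

(* [G m z] is the probability of being in [z] after [m] steps without having
   visited [y]; the mean of [h] under [G m] drops by about [del] times the
   survival probability at each step. *)
Lemma killed_sum_bounds (R : realType) (S : finType) (p : S -> S -> R)
    (h : S -> R) (x0 y : S) (G : nat -> S -> R) (del eps : R) :
  x0 != y -> (forall m z, 0 <= G m z) -> (forall z, G 0%N z = (z == x0)%:R) ->
  (forall m z, G m.+1 z = if z == y then 0 else \sum_a G m a * p a z) ->
  (forall z, 0 <= h z) -> h y = 0 -> 0 < del -> 0 < eps -> eps < 1 ->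
  (forall x, x != y -> `|\sum_z p x z * h z - h x + del| <= eps * del) ->
  exists2 s : R, (\sum_(0 <= m <oo) (del * \sum_z G m z)%:E)%E = s%:E &
    (1 - eps) * s <= h x0 <= (1 + eps) * s.
Proof.
move=> x0y G0 GO GS h0 hy del0 eps0 eps1 drop.
pose e m := \sum_z G m z * h z.
pose s m := \sum_z G m z.
pose u m := del * s m.
have u0 m : 0 <= u m by rewrite mulr_ge0 ?(ltW del0)//; exact: sumr_ge0.
have e0 m : 0 <= e m by rewrite sumr_ge0// => z _; rewrite mulr_ge0.
have Gy m : G m y = 0.
  by case: m => [|m]; rewrite ?GO ?GS ?eqxx// eq_sym (negbTE x0y).
(* Killing at [y] does not affect the mean of [h], because [h y = 0]. *)
have eS m : e m.+1 = \sum_a G m a * \sum_z p a z * h z.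
  under [RHS]eq_bigr do rewrite mulr_sumr.
  rewrite exchange_big /e; apply: eq_bigr => z _ /=; rewrite GS.
  case: eqVneq => [->|_]; last first.
    by rewrite mulr_suml; apply: eq_bigr => a _; rewrite mulrA.
  by rewrite hy mulr0 big1// => a _; rewrite !mulr0.
have step m : `|e m.+1 - e m + u m| <= eps * u m.
  have -> : e m.+1 - e m + u m =
      \sum_a G m a * (\sum_z p a z * h z - h a + del).
    rewrite eS /e /u /s mulr_sumr -sumrB -big_split/=.
    by apply: eq_bigr => a _; rewrite mulrDr mulrBr [del * _]mulrC.
  rewrite (le_trans (ler_norm_sum _ _ _))// /u /s !mulr_sumr ler_sum// => a _.
  rewrite normrM ger0_norm// mulrA mulrC; case: (eqVneq a y) => [->|ay].
    by rewrite Gy !mulr0.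
  by rewrite ler_wpM2r// drop.
(* The one-step drops telescope: the total drop [h x0 - e n] equals the accumulated time up to a
   relative error [eps]. *)
have tele n : `|e n - h x0 + series u n| <= eps * series u n.
  elim: n => [|n IHn].
    rewrite /series/= !big_geq// mulr0 addr0 /e (bigD1 x0)//= big1 => [|z zx].
      by rewrite GO eqxx mul1r addr0 subrr normr0.
    by rewrite GO (negbTE zx) mul0r.
  rewrite seriesSr mulrDr (_ : _ - _ + _ =
    (e n - h x0 + series u n) + (e n.+1 - e n + u n)); last by ring.
  by rewrite (le_trans (ler_normD _ _))// lerD.
have ub n : (1 - eps) * series u n <= h x0.
  have := tele n; rewrite ler_norml => /andP[_]; have := e0 n; lra.
have cu : cvgn (series u).
  apply: nondecreasing_is_cvgn; first exact: nondecreasing_series.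
  exists (h x0 / (1 - eps)) => _ [n _ <-].
  by rewrite ler_pdivlMr ?subr_gt0// mulrC ub.
exists (limn (series u)).
  rewrite (_ : (fun n => _) = EFin \o series u) ?EFin_lim//.
  by apply/funext => n; rewrite /= sumEFin.
apply/andP; split.
  rewrite -ler_pdivlMl ?subr_gt0//; apply: limr_le => //; near=> n.
  by rewrite ler_pdivlMl ?subr_gt0// ub.
(* [C] bounds every value of [h], so [e n] is at most [C] times the total mass of [G n]. That mass
   is a multiple of the general term of a convergent series, hence [e n] vanishes in the limit. *)
pose C := \sum_z h z.
have eC n : e n <= C * (del^-1 * u n).
  rewrite /u mulKf ?gt_eqF// /s mulr_sumr; apply: ler_sum => z _.
  rewrite mulrC ler_wpM2r// /C (bigD1 z)//= lerDl sumr_ge0//.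
have lim1 : ((1 + eps) * series u n + C * (del^-1 * u n)) @[n --> \oo] -->
    (1 + eps) * limn (series u) + C * (del^-1 * 0).
  apply: cvgD; first exact: cvgMl_tmp.
  have u_0 := cvg_series_cvg_0 cu.
  by apply: cvgMl_tmp; apply: cvgMl_tmp; exact: u_0.
rewrite mulr0 mulr0 addr0 in lim1; rewrite -(cvg_lim _ lim1)//.
apply: limr_ge; first by apply/cvg_ex; eexists; exact: lim1.
near=> n.
have := tele n; rewrite ler_norml => /andP[+ _]; have := eC n; lra.
Unshelve. all: by end_near. Qed.

(** * From the generator to the mean hitting time *)

Lemma cvg_bigsum (R : numFieldType) (T I : Type) (F : set_system T)
    (FF : Filter F) (r : seq I) (Q : pred I) (g : I -> T -> R) (l : I -> R) :
  (forall i, Q i -> g i x @[x --> F] --> l i) ->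
  \sum_(i <- r | Q i) g i x @[x --> F] --> \sum_(i <- r | Q i) l i.
Proof.
move=> gl; elim: r => [|i r IHr].
  by under eq_fun do rewrite big_nil; rewrite big_nil; exact: cvg_cst.
rewrite big_cons; under eq_fun do rewrite big_cons.
by case: ifP => // Qi; apply: cvgD => //; exact: gl.
Qed.

(** First-order expansion at time 0. As the rows of [p] sum to 1, [h] enters only through the
    differences [h z - h x], which leaves the off-diagonal rates; finiteness of [S] gives one
    threshold for all [x]. *)
Lemma transition_function_drift (R : realType) (S : finType)
    (q : S -> S -> R) (p : R -> S -> S -> R) (y : S) (h : S -> R) (eps : R) :
  transition_function q p ->
  (forall x, x != y -> \sum_z q x z * (h z - h x) = -1) -> 0 < eps ->
  \forall del \near 0^'+, forall x, x != y ->
    `|\sum_z p del x z * h z - h x + del| <= eps * del.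
Proof.
move=> tf qh eps0; apply: filter_forall => x.
case: (eqVneq x y) => [_|xy]; first by near=> del.
have lim1 : \sum_z (del^-1 * p del x z) * (h z - h x) @[del --> 0^'+] -->
    \sum_z q x z * (h z - h x).
  rewrite [X in _ --> X](bigD1 x)//= subrr mulr0.
  under eq_fun do rewrite (bigD1 x)//= subrr mulr0.
  apply: cvgD; first exact: cvg_cst.
  apply: cvg_bigsum => z zx; apply: cvgM; last exact: cvg_cst.
  by apply: (tf_rate tf); rewrite eq_sym.
rewrite qh// in lim1.
have {lim1}/cvgrPdist_le/(_ _ eps0) lim1 := lim1.
near=> del => _.
have del0 : 0 < del by near: del; exact: nbhs_right_gt.
have -> : \sum_z p del x z * h z - h x + del =
    - (del * (-1 - \sum_z (del^-1 * p del x z) * (h z - h x))).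
  rewrite mulrBr mulr_sumr.
  under [in RHS]eq_bigr do rewrite mulrA mulVKf ?gt_eqF// mulrBr.
  by rewrite sumrB -mulr_suml (tf_sum tf) ?ltW//; ring.
rewrite normrN normrM gtr0_norm// mulrC ler_wpM2r ?(ltW del0)//.
by near: del.
Unshelve. all: by end_near. Qed.

Lemma avoidsE (R : realType) (S : finType) (T : Type)
    (X : R -> T -> S) (y : S) (del : R) (m : nat) :
  [set w | avoids X y del m w] =
  path_event X (fun j => j%:R * del)
    (fun x : {ffun 'I_m.+1 -> S} => [forall j : 'I_m, x (lift ord0 j) != y]).
Proof.
apply/seteqP; split => w /= /forallP H; apply/forallP => j.
  by rewrite ffunE; exact: H.
by have := H j; rewrite ffunE.
Qed.

Lemma measurable_avoids (R : realType) (S : finType) (d : measure_display)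
    (T : measurableType d) (X : R -> T -> S) (y : S) (del : R) (m : nat) :
  (forall (s : R) x, 0 <= s -> measurable [set w | X s w = x]) -> 0 <= del ->
  measurable [set w | avoids X y del m w].
Proof.
move=> mX del0; rewrite avoidsE; apply: measurable_path_event => // j.
by rewrite mulr_ge0.
Qed.

Lemma sampled_termE (R : realType) (S : finType) (T : Type)
    (X : R -> T -> S) (y : S) (del : R) (m : nat) (w : T) :
  ((if avoids X y del m w then del else 0)%:E =
   del%:E * (\1_[set w | avoids X y del m w] w)%:E)%E.
Proof.
rewrite indicE -EFinM; case: ifPn => Hw.
  by rewrite mem_set// mulr1.
by rewrite memNset ?mulr0//=; exact/negP.
Qed.

Lemma measurable_sampled_time (R : realType) (S : finType)
    (d : measure_display) (T : measurableType d) (X : R -> T -> S) (y : S)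
    (del : R) :
  (forall (s : R) x, 0 <= s -> measurable [set w | X s w = x]) -> 0 <= del ->
  measurable_fun setT (sampled_time X y del).
Proof.
move=> mX del0; rewrite /sampled_time.
apply: (@ge0_emeasurable_sum _ _ _ _
  (fun m w => (if avoids X y del m w then del else 0)%:E) xpredT) => [k x _ _|k _].
  by rewrite lee_fin; case: ifP.
under eq_fun do rewrite sampled_termE -EFinM.
apply/measurable_EFinP; apply: measurable_funM; first exact: measurable_cst.
by apply: measurable_indic; exact: measurable_avoids.
Qed.

(** Nonnegativity allows the series and the integral to be exchanged. Each survival probability is
    then split by the current position, to fit [killed_sum_bounds]. *)
Lemma integral_sampled_time (R : realType) (S : finType)
    (d : measure_display) (T : measurableType d) (P : probability T R)
    (X : R -> T -> S) (y : S) (del : R) :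
  (forall (s : R) x, 0 <= s -> measurable [set w | X s w = x]) -> 0 <= del ->
  (\int[P]_w sampled_time X y del w =
   \sum_(0 <= m <oo) (del * \sum_z fine (P ([set w | avoids X y del m w] `&`
     [set w | X (m%:R * del) w = z])))%:E)%E.
Proof.
move=> mX del0; rewrite /sampled_time.
have mA m : measurable [set w | avoids X y del m w].
  exact: measurable_avoids.
rewrite integral_nneseries//; last 2 first.
- move=> m; under eq_fun do rewrite sampled_termE -EFinM.
  apply/measurable_EFinP; apply: measurable_funM; first exact: measurable_cst.
  exact: measurable_indic.
- by move=> m w _; rewrite lee_fin; case: ifP.
apply: eq_eseriesr => m _.
under eq_integral do rewrite sampled_termE.
rewrite ge0_integralZl_EFin//; last first.
  by apply/measurable_EFinP; exact: measurable_indic.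
rewrite integral_indic// setIT EFinM; congr (_ * _)%E.
rewrite -(fine_measure_fiber_sum P (Y := X (m%:R * del)))//.
  by rewrite fineK// fin_num_measure.
by move=> z; apply: mX; rewrite mulr_ge0.
Qed.

Lemma integral_sampled_time_bounds (R : realType) (S : finType)
    (p : R -> S -> S -> R) (x0 y : S)
    (d : measure_display) (T : measurableType d) (P : probability T R)
    (X : R -> T -> S) (h : S -> R) (del eps : R) :
  (forall (s : R) x, 0 <= s -> measurable [set w | X s w = x]) ->
  P [set w | X 0 w = x0] = 1%E ->
  (forall (n : nat) (t : nat -> R) (x : nat -> S),
      0 <= t 0%N -> (forall m, (m <= n)%N -> t m <= t m.+1) ->
      P [set w | forall m, (m <= n.+1)%N -> X (t m) w = x m] =
      (P [set w | forall m, (m <= n)%N -> X (t m) w = x m] *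
       (p (t n.+1 - t n) (x n) (x n.+1))%:E)%E) ->
  x0 != y -> (forall z, 0 <= h z) -> h y = 0 -> 0 < del -> 0 < eps -> eps < 1 ->
  (forall x, x != y -> `|\sum_z p del x z * h z - h x + del| <= eps * del) ->
  exists2 s : R, (\int[P]_w sampled_time X y del w)%E = s%:E &
    (1 - eps) * s <= h x0 <= (1 + eps) * s.
Proof.
move=> mX X0 mk x0y h0 hy del0 eps0 eps1 drop.
rewrite integral_sampled_time ?(ltW del0)//.
pose t (j : nat) : R := j%:R * del.
have t0 j : 0 <= t j by rewrite mulr_ge0// ltW.
pose G m z := fine (P ([set w | avoids X y del m w] `&`
  [set w | X (m%:R * del) w = z])).
apply: (@killed_sum_bounds R S (p del) h x0 y G) => //.
- by move=> m z; rewrite fine_ge0.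
- move=> z; rewrite /G (_ : _ `&` _ = [set w | X 0 w = z]); last first.
    apply/seteqP; split => w /=; rewrite mul0r; first by case.
    by split => //; apply/forallP => -[].
  case: eqVneq => [->|zx0]; first by rewrite X0.
  have -> : P [set w | X 0 w = z] = 0%E; last by [].
  apply/eqP; rewrite eq_le measure_ge0 andbT.
  apply: (@le_trans _ _ (P (~` [set w | X 0 w = x0]))).
    apply: le_measure; rewrite ?inE; [exact: mX|exact/measurableC/mX|].
    by move=> w /= -> zx; move: zx0; rewrite zx eqxx.
  by rewrite probability_setC ?X0 ?subee//; exact: mX.
- move=> m z; rewrite /G; case: eqVneq => [->|zy].
    rewrite (_ : _ `&` _ = set0) ?measure0//.
    apply/seteqP; split => // w [/= /forallP/(_ ord_max)/=].
    by move=> /eqP.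
  (* Ending at [z != y] already ensures that the last grid time is not a visit, so avoidance is only
     required up to step [m]. *)
  rewrite (_ : _ `&` _ = [set w | avoids X y del m w] `&`
      [set w | X (t m.+1) w = z]); last first.
    apply/seteqP; split => w [/= /forallP A Xz]; split => //=; apply/forallP => j.
      exact: (A (widen_ord (leqnSn m) j)).
    case: (unliftP ord_max j) => [i|] -> /=; last by rewrite Xz.
    by rewrite /bump leqNgt ltn_ord; exact: (A i).
  rewrite avoidsE (@markov_path_event _ _ _ _ _ _ p)//.
    apply: eq_bigr => a _; congr (_ * p _ _ _).
    by rewrite /t -mulrBl -natrB// subSnn mul1r.
  move=> x; apply: mk => [|j _]; first exact: (t0 0).
  by rewrite /t ler_wpM2r ?ler_nat// ltW.
Qed.

Lemma expected_transition_time (R : realType) (S : finType)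
    (q : S -> S -> R) (x0 y : S) (d : measure_display) (T : measurableType d)
    (P : probability T R) (X : R -> T -> S) (h : S -> R) :
  markov_process q x0 P X -> x0 != y -> (forall z, 0 <= h z) -> h y = 0 ->
  (forall x, x != y -> \sum_z q x z * (h z - h x) = -1) ->
  (\int[P]_w transition_time X y w = (h x0)%:E)%E.
Proof.
case=> mX rc X0 [p tf mk] x0y h0 hy qh.
(* Dyadic steps make the grids nested, hence the sampled times decrease with [n]. *)
pose del n : R := 2^-1 ^+ n.
have del0 n : 0 < del n by rewrite exprn_gt0.
have delcvg : del n @[n --> \oo] --> 0.
  by apply: cvg_expr; rewrite gtr0_norm// invf_lt1// ltr1n.
have bounds eps : 0 < eps -> eps < 1 -> \forall n \near \oo,
    exists2 s : R, (\int[P]_w sampled_time X y (del n) w)%E = s%:E &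
    (1 - eps) * s <= h x0 <= (1 + eps) * s.
  move=> eps0 eps1.
  have := transition_function_drift tf qh eps0.
  move=> [r /= r0 drift]; near=> n.
  apply: (integral_sampled_time_bounds mX X0 mk) => //.
  apply: drift => //=; rewrite sub0r normrN gtr0_norm//.
  near: n; exact: (cvgr_lt _ delcvg).
have cvgI : (\int[P]_w sampled_time X y (del n) w)%E @[n --> \oo] -->
    (h x0)%:E.
  apply/fine_cvgP; split.
    have half : (2^-1 : R) < 1 by rewrite invf_lt1// ltr1n.
    near=> n; have [s -> _ //] : exists2 s : R,
      (\int[P]_w sampled_time X y (del n) w)%E = s%:E &
      (1 - 2^-1) * s <= h x0 <= (1 + 2^-1) * s.
    by near: n; exact: bounds.
  apply/cvgrPdist_le => e e0.
  (* [eps <= 2^-1] gives [s <= 2 * h x0], so the error [eps * s] is at most [e]; the added 1 keeps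
     the denominator positive when [h x0 = 0]. *)
  pose eps := Num.min 2^-1 (e / (2 * h x0 + 1)).
  have c0 : 0 < 2 * h x0 + 1 by have := h0 x0; lra.
  have eps0 : 0 < eps by rewrite lt_min divr_gt0// invr_gt0 ltr0n.
  have epsl : eps <= 2^-1 by rewrite ge_min lexx.
  have eps1 : eps < 1 by lra.
  have epsr : eps * (2 * h x0 + 1) <= e.
    by rewrite -ler_pdivlMr// ge_min lexx orbT.
  near=> n.
  have [s sE /andP[b1 b2]] : exists2 s : R,
      (\int[P]_w sampled_time X y (del n) w)%E = s%:E &
      (1 - eps) * s <= h x0 <= (1 + eps) * s by near: n; exact: bounds.
  have s0 : 0 <= s by have := h0 x0; nra.
  have s2 : s <= 2 * h x0 by nra.
  have es : eps * s <= e by nra.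
  by rewrite /= sE /= ler_norml; lra.
(* From index [N] on the mean is finite; the sampled time at [N] dominates all later ones, whence
   the shift by [N] below. *)
have [N _ HN] : \forall n \near \oo,
    (\int[P]_w sampled_time X y (del n) w < +oo)%E.
  have half : (2^-1 : R) < 1 by rewrite invf_lt1// ltr1n.
  have half0 : (0 : R) < 2^-1 by rewrite invr_gt0.
  by apply: filterS (bounds _ half0 half) => n [s -> _]; rewrite ltry.
have mS n : measurable_fun setT (sampled_time X y (del n)).
  by apply: measurable_sampled_time => //; exact: ltW.
have S0 n w : (0 <= sampled_time X y (del n) w)%E.
  by apply: sampled_time_ge0; exact: ltW.
have cvgS w : sampled_time X y (del n) w @[n --> \oo] --> transition_time X y w.
  by apply: sampled_time_cvg => // t t0; exact: rc.
have mono n w : (N <= n)%N ->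
    (sampled_time X y (del n) w <= sampled_time X y (del N) w)%E.
  move=> Nn; apply: (@sampled_time_refine _ _ _ _ _ _ _ (2 ^ (n - N)).-1) => //.
  rewrite prednK ?expn_gt0// /del natrX -{2}(subnK Nn) exprD mulrA -exprMn.
  by rewrite mulfV// expr1n mul1r.
have : (\int[P]_w sampled_time X y (del (n + N)%N) w)%E @[n --> \oo] -->
    (\int[P]_w transition_time X y w)%E.
  have [] := @dominated_convergence _ _ _ P setT measurableT
    (fun n => sampled_time X y (del (n + N)%N)) (transition_time X y)
    (sampled_time X y (del N)) => //.
  - exact: (emeasurable_fun_cvg _ _ mS (fun w _ => cvgS w)).
  - apply/aeW => w _.
    by have := cvgS w; rewrite -(cvg_shiftn N).
  - apply/integrableP; split => //.
    rewrite (eq_integral (sampled_time X y (del N))).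
      exact: (HN N (leqnn N)).
    by move=> w _; rewrite gee0_abs.
  - by apply/aeW => w n _; rewrite gee0_abs// mono// leq_addl.
rewrite -(cvg_shiftn N) in cvgI => c2.
by rewrite -(cvg_lim _ c2)//; apply: cvg_lim => //; exact: cvgI.
Unshelve. all: by end_near. Qed.

(** * The star: generator, one-edge passage times, exact mean transition time *)

Lemma big_option (R : nmodType) (T : finType) (F : option T -> R) :
  \sum_x F x = F None + \sum_x F (Some x).
Proof.
rewrite (bigD1 None)//=; congr (_ + _).
by rewrite (reindex_omap Some id) => [|[]//]; apply: eq_bigl => x; rewrite eqxx.
Qed.

Definition star_fun (R : realType) (K : nat) (L : 'I_K -> nat) (g0 : R)
    (g : 'I_K -> nat -> R) (x : star_state L) : R :=
  if x is Some u then g (branch u) (level u) else g0.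

Lemma star_generator0 (R : realType) (K : nat) (L : 'I_K -> nat)
    (a : 'I_K -> R) (g0 : R) (g : 'I_K -> nat -> R) :
  (forall k, (0 < L k)%N) ->
  \sum_(z : star_state L) star_rate a None z * (star_fun g0 g z - g0) =
  \sum_k (L k)%:R * a k * (g k 1 - g0) :> R.
Proof.
move=> L0; rewrite (@big_option _ {k : 'I_K & 'I_(L k)})/= mul0r add0r.
rewrite -(@sig_big_dep _ _ _ _ (fun k => 'I_(L k)) xpredT (fun _ => xpredT)
  (fun k j => (if j.+1 == 1 then (L k)%:R * a k else 0) * (g k j.+1 - g0))).
apply: eq_bigr => k _; rewrite -(big_mkord xpredT (fun j =>
  (if j.+1 == 1 then (L k)%:R * a k else 0) * (g k j.+1 - g0))).
rewrite big_ltn//= big_nat big1 ?addr0// => -[|j]// _.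
by rewrite mul0r.
Qed.

(** With [g k 0 = g0] the centre serves as level 0 of every branch, so the generator takes the form
    of a birth-death chain at all levels, including the first and the last. *)
Lemma star_generatorS (R : realType) (K : nat) (L : 'I_K -> nat)
    (a : 'I_K -> R) (g0 : R) (g : 'I_K -> nat -> R) (k : 'I_K) (l : 'I_(L k)) :
  g k 0 = g0 ->
  \sum_z star_rate a (star_node l) z * (star_fun g0 g z - g k l.+1) =
  (L k - l.+1)%:R * a k * (g k l.+2 - g k l.+1) +
  l.+1%:R * (g k l - g k l.+1) :> R.
Proof.
move=> g0E; rewrite (@big_option _ {k : 'I_K & 'I_(L k)})/=.
rewrite -(@sig_big_dep _ _ _ _ (fun k => 'I_(L k)) xpredT (fun _ => xpredT)
  (fun i j => (if k != i then 0 else if j.+1 == l.+2 then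
      (L k - l.+1)%:R * a k else if l.+1 == j.+2 then l.+1%:R else 0)
     * (g i j.+1 - g k l.+1))).
rewrite (bigD1 k)//= [X in _ + (_ + X)]big1 ?addr0; last first.
  by move=> i ik; rewrite big1// => j _; rewrite eq_sym ik mul0r.
rewrite eqxx/=.
rewrite (eq_bigr (fun j : 'I_(L k) =>
    (if j == l.+1 :> nat then (L k - l.+1)%:R * a k * (g k j.+1 - g k l.+1) else 0)
  + (if (0 < l)%N && (j == l.-1 :> nat) then l.+1%:R * (g k j.+1 - g k l.+1) else 0)));
  last first.
  move=> j _; rewrite !eqSS; case: (eqVneq (j : nat) l.+1) => [->|jl].
    case: ifP => [/andP[l0 /eqP]|_]; last by rewrite addr0.
    by lia.
  rewrite add0r (_ : (_ && _) = (l == j.+1 :> nat)); last by lia.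
  by case: ifP => _; rewrite ?mul0r.
rewrite big_split/= -!big_mkcond/=.
rewrite (big_ord1_eq _ (fun j => (L k - l.+1)%:R * a k *
  (g k j.+1 - g k l.+1))).
(* At the end of the branch there is no upper neighbour, but the coefficient [L k - l.+1] is then
   0. *)
rewrite (_ : (if _ then _ else _) =
    (L k - l.+1)%:R * a k * (g k l.+2 - g k l.+1)); last first.
  by case: ltnP => // ll; rewrite (eqP ll) !mul0r.
rewrite addrCA; congr (_ + _).
rewrite /level/= eqSS; have [l0|l0] := posnP l.
  by rewrite l0 /= big_pred0// addr0 g0E.
rewrite mul0r add0r.
case: (l : nat) l0 (ltn_ord l) => // m _ ml /=.
by rewrite (big_ord1_eq _ (fun j => m.+2%:R * (g k j.+1 - g k m.+2))) ltnW.
Qed.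

(* The stationary weight of level [j] of a branch of length [n], relative to
   the centre. *)
Definition bin_weight (R : realType) (n : nat) (a : R) (j : nat) : R :=
  'C(n, j)%:R * a ^+ j.

(* Mean times from level [i] to level [i.-1], and from level [i] to level
   [i.+1] when [w] is the stationary weight of everything outside the branch. *)
Definition down_time (R : realType) (n : nat) (a : R) (i : nat) : R :=
  (\sum_(i <= j < n.+1) bin_weight n a j) / (i%:R * bin_weight n a i).

Definition up_time (R : realType) (w : R) (n : nat) (a : R) (i : nat) : R :=
  (w + \sum_(1 <= j < i.+1) bin_weight n a j) /
  ((n - i)%:R * a * bin_weight n a i).

Lemma bin_weight_gt0 (R : realType) (n : nat) (a : R) (j : nat) :
  0 < a -> (j <= n)%N -> 0 < bin_weight n a j.
Proof. by move=> a0 jn; rewrite mulr_gt0 ?exprn_gt0// ltr0n bin_gt0. Qed.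

Lemma bin_weight_ge0 (R : realType) (n : nat) (a : R) (j : nat) :
  0 <= a -> 0 <= bin_weight n a j.
Proof. by move=> a0; rewrite mulr_ge0 ?exprn_ge0. Qed.

(** Detailed balance: both sides are the stationary flow through the edge between levels [j] and
    [j.+1]. *)
Lemma bin_weightS (R : realType) (n : nat) (a : R) (j : nat) :
  j.+1%:R * bin_weight n a j.+1 = (n - j)%:R * a * bin_weight n a j.
Proof.
rewrite /bin_weight mulrA -natrM mul_bin_left natrM exprS.
by rewrite !mulrA; congr (_ * _); rewrite -!mulrA [a * _]mulrC.
Qed.

Lemma down_time_ge0 (R : realType) (n : nat) (a : R) (i : nat) :
  0 <= a -> 0 <= down_time n a i.
Proof.
move=> a0; apply: divr_ge0; last by rewrite mulr_ge0 ?bin_weight_ge0.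
by apply: sumr_ge0 => j _; exact: bin_weight_ge0.
Qed.

Lemma up_time_ge0 (R : realType) (w : R) (n : nat) (a : R) (i : nat) :
  0 <= w -> 0 <= a -> 0 <= up_time w n a i.
Proof.
move=> w0 a0; apply: divr_ge0; last first.
  by apply: mulr_ge0; [exact: mulr_ge0|exact: bin_weight_ge0].
by apply: addr_ge0 => //; apply: sumr_ge0 => j _; exact: bin_weight_ge0.
Qed.

(** First-step equation at level [l] for a target below it. By detailed balance both terms are
    weight sums divided by [bin_weight n a l], and the sums differ by just that weight. *)
Lemma down_time_rec (R : realType) (n : nat) (a : R) (l : nat) :
  0 < a -> (0 < l <= n)%N ->
  (n - l)%:R * a * down_time n a l.+1 - l%:R * down_time n a l = -1.
Proof.
move=> a0 /andP[l0 ln].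
have wl : bin_weight n a l != 0 by rewrite gt_eqF// bin_weight_gt0.
have l0' : l%:R != 0 :> R by rewrite pnatr_eq0 -lt0n.
rewrite {2}/down_time big_ltn//.
(* At [l = n] the coefficient of [down_time n a l.+1], a quotient with denominator 0, is itself
   0. *)
have [ltn|] := ltnP l n; last first.
  move=> nl; have nE : n = l by lia.
  rewrite nE in wl *; rewrite subnn big_geq// !mul0r addr0 sub0r; congr (- _).
  by field; rewrite l0' wl.
rewrite /down_time bin_weightS.
have nl0 : (n - l)%:R != 0 :> R by rewrite pnatr_eq0 subn_eq0 -ltnNge.
by field; rewrite nl0 wl l0' gt_eqF.
Qed.

(** The same cancellation for a target above: the sums now contain the outside weight [w] and differ
    by the weight of level [l.+1]. *)
Lemma up_time_rec (R : realType) (w : R) (n : nat) (a : R) (l : nat) :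
  0 < a -> (l.+1 < n)%N ->
  l.+1%:R * up_time w n a l - (n - l.+1)%:R * a * up_time w n a l.+1 = -1.
Proof.
move=> a0 ln.
have wl : bin_weight n a l.+1 != 0 by rewrite gt_eqF// bin_weight_gt0// ltnW.
rewrite /up_time -bin_weightS [in X in _ - X]big_nat_recr//=.
have nl0 : (n - l.+1)%:R != 0 :> R by rewrite pnatr_eq0 subn_eq0 -ltnNge.
have l1 : l.+1%:R != 0 :> R by rewrite pnatr_eq0.
set s := \sum_(_ <= _ < _) _.
by field; rewrite nl0 wl nat1r l1 gt_eqF.
Qed.

Lemma up_time0 (R : realType) (w : R) (n : nat) (a : R) :
  up_time w n a 0 = w / (n%:R * a).
Proof. by rewrite /up_time subn0 big_geq// /bin_weight bin0 expr0 !mulr1 addr0. Qed.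

(** The centre has weight 1, so the entrance rate [n%:R * a] is also the flow and cancels the
    denominator. This is the term of the branch in the first-step equation at the centre. *)
Lemma down_time1 (R : realType) (n : nat) (a : R) :
  (0 < n)%N -> 0 < a ->
  n%:R * a * down_time n a 1 = \sum_(1 <= j < n.+1) bin_weight n a j.
Proof.
move=> n0 a0; rewrite /down_time bin_weightS subn0 /bin_weight bin0 expr0 !mulr1.
by rewrite mulrC divfK// mulf_neq0 ?gt_eqF// ltr0n.
Qed.

(** The [w] of [up_time] in branch [k2]: stationary weight of the rest of the star, the leading 1
    being that of the centre. *)
Definition outer_weight (R : realType) (K : nat) (L : 'I_K -> nat)
    (a : 'I_K -> R) (k2 : 'I_K) : R :=
  1 + \sum_(k | k != k2) \sum_(1 <= j < (L k).+1) bin_weight (L k) (a k) j.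

(** Passage times are added along the tree path from level [l] of branch [k] to level [m] of branch
    [k2]; level 0 stands for the centre. For [k = k2] at most one of the two sums is non-empty,
    according to the side of [m] on which [l] lies. *)
Definition mean_time (R : realType) (K : nat) (L : 'I_K -> nat)
    (a : 'I_K -> R) (k2 : 'I_K) (m : nat) (k : 'I_K) (l : nat) : R :=
  let up := up_time (outer_weight L a k2) (L k2) (a k2) in
  if k == k2 then
    \sum_(l <= i < m) up i + \sum_(m.+1 <= i < l.+1) down_time (L k2) (a k2) i
  else \sum_(0 <= i < m) up i + \sum_(1 <= i < l.+1) down_time (L k) (a k) i.

Lemma outer_weight_ge0 (R : realType) (K : nat) (L : 'I_K -> nat)
    (a : 'I_K -> R) (k2 : 'I_K) :
  (forall k, 0 <= a k) -> 0 <= outer_weight L a k2.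
Proof.
move=> a0; apply: addr_ge0 => //; apply: sumr_ge0 => k _.
apply: sumr_ge0 => j _; exact: bin_weight_ge0.
Qed.

Lemma mean_time_ge0 (R : realType) (K : nat) (L : 'I_K -> nat)
    (a : 'I_K -> R) (k2 : 'I_K) (m : nat) (k : 'I_K) (l : nat) :
  (forall k, 0 <= a k) -> 0 <= mean_time L a k2 m k l.
Proof.
move=> a0; rewrite /mean_time; case: ifP => _; apply: addr_ge0;
  apply: sumr_ge0 => i _; rewrite ?down_time_ge0// up_time_ge0//;
  exact: outer_weight_ge0.
Qed.

Lemma mean_time0 (R : realType) (K : nat) (L : 'I_K -> nat)
    (a : 'I_K -> R) (k2 : 'I_K) (m : nat) (k : 'I_K) : (0 < m)%N ->
  mean_time L a k2 m k 0 =
  \sum_(0 <= i < m) up_time (outer_weight L a k2) (L k2) (a k2) i.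
Proof.
by move=> m0; rewrite /mean_time; case: ifP => _; rewrite [X in _ + X]big_geq ?addr0.
Qed.

Lemma expected_star_transition_time (R : realType) (K : nat) (L : 'I_K -> nat)
    (a : 'I_K -> R) (k1 k2 : 'I_K) (l1 : 'I_(L k1)) (l2 : 'I_(L k2))
    (d : measure_display) (T : measurableType d) (P : probability T R)
    (X : R -> T -> star_state L) :
  (forall k, (0 < L k)%N) -> (forall k, 0 < a k) -> k1 != k2 ->
  markov_process (star_rate a) (star_node l1) P X ->
  (\int[P]_w transition_time X (star_node l2) w =
   (mean_time L a k2 l2.+1 k1 l1.+1)%:E)%E.
Proof.
move=> L0 a0 k12 mp.
have a0' k : 0 <= a k by exact: ltW.
pose g := mean_time L a k2 l2.+1.
pose g0 := \sum_(0 <= i < l2.+1) up_time (outer_weight L a k2) (L k2) (a k2) i.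
have gE k : g k 0 = g0 by exact: mean_time0.
have := @expected_transition_time _ _ _ _ (star_node l2) _ _ _ _
  (star_fun g0 g) mp; apply.
- apply/eqP => /(congr1 (fun x : star_state L => omap (@branch _ L) x)) -[].
  by move/eqP; exact/negP.
- move=> [u|]/=; first exact: mean_time_ge0.
  by rewrite /g0 -(mean_time0 L a k2 k2)// mean_time_ge0.
- by rewrite /= /g /mean_time eqxx !big_geq ?addr0.
move=> [[k l]|] xy.
  rewrite -/(star_node l) [LHS](star_generatorS a l (gE k)).
  have [kk2|kk2] := eqVneq k k2; last first.
    rewrite /g /mean_time (negbTE kk2) [X in _ * (_ + X - _)]big_nat_recr//=.
    rewrite [X in _ + _ * (_ - (_ + X))]big_nat_recr//=.
    have := @down_time_rec _ (L k) (a k) l.+1 (a0 k); rewrite ltn_ord => /(_ isT).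
    set D := \sum_(_ <= _ < _) _; set D' := \sum_(_ <= _ < _) _.
    by lra.
  subst k.
  (* Inside branch [k2], levels beyond the target obey the downward recursion and levels before it
     the upward one; the target itself is excluded by [xy]. *)
  have [ll2|] := ltnP l2 l.
    have := @down_time_rec _ (L k2) (a k2) l.+1 (a0 k2).
    rewrite ltn_ord => /(_ isT).
    rewrite /g /mean_time eqxx.
    have E F j : (l <= j)%N -> \sum_(j <= i < l2.+1) F i = 0 :> R.
      by move=> lj; rewrite big_geq//; lia.
    rewrite (E _ l)// (E _ l.+1)// (E _ l.+2); last by lia.
    rewrite [X in _ * (_ + X - _)]big_nat_recr//=; last by rewrite ltnS ltnW.
    rewrite [X in _ + _ * (_ - (_ + X))]big_nat_recr//=.
    set D := \sum_(_ <= _ < _) _.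
    by lra.
  rewrite leq_eqVlt => /predU1P[ll2|ll2].
    move: xy; have -> : l = l2 by exact: val_inj.
    by rewrite eqxx.
  have := @up_time_rec _ (outer_weight L a k2) (L k2) (a k2) l (a0 k2).
  move=> /(_ (leq_ltn_trans ll2 (ltn_ord l2))).
  rewrite /g /mean_time eqxx.
  have E F j : (j <= l2.+2)%N -> \sum_(l2.+2 <= i < j) F i = 0 :> R.
    by move=> jl; rewrite big_geq.
  rewrite (E _ l.+1) ?(E _ l.+2) ?(E _ l.+3); try by lia.
  rewrite (@big_ltn _ _ _ l l2.+1); last by lia.
  rewrite (@big_ltn _ _ _ l.+1 l2.+1); last by lia.
  set D := \sum_(_ <= _ < _) _.
  by lra.
(* At the centre, branch [k2] contributes minus [outer_weight] and every other branch its own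
   stationary weight; what remains is minus the weight of the centre. *)
rewrite [LHS]star_generator0// (bigD1 k2)//=.
rewrite (eq_bigr (fun k => \sum_(1 <= j < (L k).+1) bin_weight (L k) (a k) j)).
  rewrite /g /mean_time eqxx /g0 [\sum_(l2.+2 <= _ < _) _]big_geq//.
  rewrite (@big_ltn _ _ _ 0 l2.+1)// addr0 opprD addrCA subrr addr0.
  rewrite up_time0 mulrN mulrCA mulfV ?mulr1.
    by rewrite /outer_weight; lra.
  by rewrite mulf_neq0 ?gt_eqF// ltr0n.
move=> k kk2; rewrite /g /mean_time (negbTE kk2) addrC addKr big_nat1.
exact: down_time1.
Qed.

(** * Asymptotics as the rates blow up *)

Lemma cvg_exprn_ratio (R : realType) (T : Type) (F : set_system T)
    (FF : Filter F) (a : T -> R) (i j : nat) :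
  a x @[x --> F] --> +oo -> (i <= j)%N ->
  a x ^+ i / a x ^+ j @[x --> F] --> ((i == j)%:R : R).
Proof.
move=> aoo /subnKC <-; set m := (j - i)%N.
have a_gt0 : \forall x \near F, 0 < a x.
  by move/cvgryPgt : aoo; apply.
have ainv : (a x)^-1 @[x --> F] --> 0 by apply/gtr0_cvgV0.
have -> : (i == i + m)%N = (m == 0)%N by lia.
have pw : (a x)^-1 ^+ m @[x --> F] --> ((m == 0)%:R : R).
  elim: m => [|m IHm]; first by under eq_fun do rewrite expr0; exact: cvg_cst.
  under eq_fun do rewrite exprS.
  by rewrite /= -[_%:R](mul0r (m == 0)%:R); exact: cvgM.
apply: cvg_trans pw; apply: near_eq_cvg; near=> x.
have ax : a x != 0 by rewrite gt_eqF//; near: x.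
by rewrite exprD invfM mulrA mulfV ?expf_neq0// mul1r exprVn.
Unshelve. all: by end_near. Qed.

(** After division, the summand [j] is a constant times a power [j] over a power [i + n.-1]. The
    exponents agree only for [j = n] and [i = 1], where the constant is 1. *)
Lemma cvg_down_time (R : realType) (T : Type) (F : set_system T)
    (FF : Filter F) (a : T -> R) (n i : nat) :
  a x @[x --> F] --> +oo -> (0 < i <= n)%N ->
  down_time n (a x) i / (n%:R^-1 * a x ^+ n.-1) @[x --> F] --> ((i == 1)%:R : R).
Proof.
move=> aoo /andP[i0 ni].
have n0 : (0 < n)%N by exact: leq_trans ni.
pose c j : R := 'C(n, j)%:R * n%:R / (i%:R * 'C(n, i)%:R).
have lim1 : \sum_(i <= j < n.+1) c j * (a x ^+ j / a x ^+ (i + n.-1))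
    @[x --> F] --> \sum_(i <= j < n.+1) c j * ((j == i + n.-1)%:R : R).
  rewrite big_seq; under eq_fun do rewrite big_seq.
  apply: cvg_bigsum => j; rewrite mem_index_iota => /andP[ij jn].
  by apply: cvgMl_tmp; apply: cvg_exprn_ratio => //; lia.
have -> : (i == 1)%:R = \sum_(i <= j < n.+1) c j * (j == i + n.-1)%:R :> R.
  rewrite big_nat_recr//= big_nat big1 => [|j /andP[ij jn]]; last first.
    by rewrite (_ : _ == _ = false) ?mulr0//; lia.
  rewrite add0r (_ : (n == _) = (i == 1)); last by lia.
  case: eqVneq => [i1|]; last by rewrite mulr0.
  by rewrite /c i1 binn bin1 !mul1r mulr1 mulfV// pnatr_eq0 -lt0n.
apply: cvg_trans lim1; apply: near_eq_cvg; near=> x.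
have ax : a x != 0.
  by rewrite gt_eqF//; near: x; move/cvgryPgt : aoo; apply.
rewrite /down_time !mulr_suml; apply: eq_bigr => j _.
rewrite /c /bin_weight exprD; field.
by rewrite !expf_neq0//= !pnatr_eq0 -!lt0n n0 i0 bin_gt0 ni.
Unshelve. all: by end_near. Qed.

Lemma cvg_bin_weight_sum (R : realType) (T : Type) (F : set_system T)
    (FF : Filter F) (a : T -> R) (n : nat) :
  a x @[x --> F] --> +oo -> (0 < n)%N ->
  (\sum_(1 <= j < n.+1) bin_weight n (a x) j) / a x ^+ n @[x --> F] --> (1 : R).
Proof.
move=> aoo n0.
have lim1 : \sum_(1 <= j < n.+1) 'C(n, j)%:R * (a x ^+ j / a x ^+ n)
    @[x --> F] --> \sum_(1 <= j < n.+1) 'C(n, j)%:R * ((j == n)%:R : R).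
  rewrite big_seq; under eq_fun do rewrite big_seq.
  apply: cvg_bigsum => j; rewrite mem_index_iota => /andP[ij jn].
  by apply: cvgMl_tmp; apply: cvg_exprn_ratio.
rewrite big_nat_recr//= eqxx binn mulr1 big_nat big1 ?add0r in lim1; last first.
  by move=> j /andP[_ jn]; rewrite (ltn_eqF jn) mulr0.
apply: cvg_trans lim1; apply: near_eq_cvg; near=> x.
by rewrite mulr_suml; apply: eq_bigr => j _; rewrite mulrA.
Unshelve. all: by end_near. Qed.

(** The relative error of the sum is the average, with weights [U] and [V], of the two relative
    errors; as both weights are positive, the bound is uniform in their proportion. *)
Lemma cvg_add_ratio (R : realType) (T : Type) (F : set_system T)
    (FF : Filter F) (A B U V : T -> R) :
  (\forall x \near F, 0 < U x) -> (\forall x \near F, 0 < V x) ->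
  A x / U x @[x --> F] --> (1 : R) -> B x / V x @[x --> F] --> (1 : R) ->
  (A x + B x) / (U x + V x) @[x --> F] --> (1 : R).
Proof.
move=> U0 V0 /cvgrPdist_le AU /cvgrPdist_le BV.
apply/cvgrPdist_le => e e0; near=> x.
have Ux : 0 < U x by near: x.
have Vx : 0 < V x by near: x.
have -> : 1 - (A x + B x) / (U x + V x) =
    ((1 - A x / U x) * U x + (1 - B x / V x) * V x) / (U x + V x).
  by field; rewrite !gt_eqF// addr_gt0.
rewrite normrM [X in _ * X]gtr0_norm ?invr_gt0 ?addr_gt0//.
rewrite ler_pdivrMr ?addr_gt0// mulrDr (le_trans (ler_normD _ _))//.
rewrite !normrM (gtr0_norm Ux) (gtr0_norm Vx).
by apply: lerD; rewrite ler_wpM2r ?(ltW Ux) ?(ltW Vx)//; near: x; [exact: AU|exact: BV].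
Unshelve. all: by end_near. Qed.

Lemma up_timeD (R : realType) (w : R) (n : nat) (a : R) (i : nat) :
  up_time w n a i = w / ((n - i)%:R * a * bin_weight n a i) + up_time 0 n a i.
Proof. by rewrite /up_time mulrDl add0r. Qed.

(** Without outside weight the numerator has degree at most [i] in [a], the denominator degree
    [i.+1]. *)
Lemma cvg_inner_up_time (R : realType) (T : Type) (F : set_system T)
    (FF : Filter F) (a : T -> R) (n i : nat) :
  a x @[x --> F] --> +oo -> (i < n)%N ->
  up_time 0 n (a x) i @[x --> F] --> (0 : R).
Proof.
move=> aoo ni.
pose c j : R := 'C(n, j)%:R / ((n - i)%:R * 'C(n, i)%:R).
have lim1 : \sum_(1 <= j < i.+1) c j * (a x ^+ j / a x ^+ i.+1)
    @[x --> F] --> \sum_(1 <= j < i.+1) c j * ((j == i.+1)%:R : R).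
  rewrite big_seq; under eq_fun do rewrite big_seq.
  apply: cvg_bigsum => j; rewrite mem_index_iota => /andP[ij jn].
  by apply: cvgMl_tmp; apply: cvg_exprn_ratio => //; lia.
rewrite big_nat big1 in lim1; last first.
  by move=> j /andP[_ jn]; rewrite (ltn_eqF jn) mulr0.
apply: cvg_trans lim1; apply: near_eq_cvg; near=> x.
have ax : a x != 0.
  by rewrite gt_eqF//; near: x; move/cvgryPgt : aoo; apply.
rewrite /up_time add0r mulr_suml; apply: eq_bigr => j _.
rewrite /c /bin_weight exprS; field.
by rewrite expf_neq0// ax !pnatr_eq0 -!lt0n bin_gt0 subn_gt0 ni ltnW.
Unshelve. all: by end_near. Qed.

(** The shares add up to exactly 1 as soon as their common denominator is positive; [k1] makes that
    denominator a non-empty sum. *)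
Lemma sum_gamma_lim (R : realType) (K : nat) (L : 'I_K -> nat)
    (f : 'I_K -> R -> R) (k1 k2 : 'I_K) :
  (forall k, f k nu @[nu --> +oo] --> +oo) -> k1 != k2 ->
  (forall k, k != k2 -> cvg (branch_share L f k2 k nu @[nu --> +oo])) ->
  \sum_(k | k != k2) gamma_lim L f k2 k = 1.
Proof.
move=> foo k12 cg.
have lim1 : \sum_(k | k != k2) branch_share L f k2 k nu @[nu --> +oo] -->
    \sum_(k | k != k2) gamma_lim L f k2 k.
  by apply: cvg_bigsum => k kk2; exact: cg.
have f_gt0 : \forall nu \near +oo, forall k, 0 < f k nu.
  by apply: filter_forall => k; have /cvgryPgt := foo k; apply.
rewrite -(cvg_lim _ lim1)//; apply: cvg_lim => //.
apply: (@cvg_trans _ (cst (1 : R) nu @[nu --> +oo])); last exact: cvg_cst.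
apply: near_eq_cvg; near=> nu.
have fnu k : 0 < f k nu by move: k; near: nu.
rewrite /branch_share -mulr_suml mulfV// gt_eqF//.
rewrite (bigD1 k1)//= ltr_pwDl ?exprn_gt0//.
by apply: sumr_ge0 => k _; rewrite exprn_ge0// ltW.
Unshelve. all: by end_near. Qed.

Lemma gamma_lim_ge0 (R : realType) (K : nat) (L : 'I_K -> nat)
    (f : 'I_K -> R -> R) (k2 k : 'I_K) :
  (forall k, f k nu @[nu --> +oo] --> +oo) ->
  cvg (branch_share L f k2 k nu @[nu --> +oo]) -> 0 <= gamma_lim L f k2 k.
Proof.
move=> foo cg; apply: limr_ge => //.
have f_gt0 : \forall nu \near +oo, forall k, 0 < f k nu.
  by apply: filter_forall => j; have /cvgryPgt := foo j; apply.
near=> nu.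
have fnu j : 0 < f j nu by move: j; near: nu.
apply: divr_ge0; first by rewrite exprn_ge0// ltW.
by apply: sumr_ge0 => j _; rewrite exprn_ge0// ltW.
Unshelve. all: by end_near. Qed.

(** Both weights are compared with the full sum [D] over [k != k2]: keeping only the dominant
    branches loses shares with limit 0, while [outer_weight] adds the centre and the inner levels,
    of lower order. *)
Lemma cvg_outer_weight_dominant (R : realType) (K : nat) (L : 'I_K -> nat)
    (f : 'I_K -> R -> R) (k1 k2 : 'I_K) :
  (forall k, (0 < L k)%N) ->
  (forall k, f k nu @[nu --> +oo] --> +oo) -> k1 != k2 ->
  (forall k, k != k2 -> cvg (branch_share L f k2 k nu @[nu --> +oo])) ->
  (\forall nu \near +oo, 0 < \sum_(k in dominant L f k2) f k nu ^+ L k) /\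
  outer_weight L (f^~ nu) k2 / (\sum_(k in dominant L f k2) f k nu ^+ L k)
    @[nu --> +oo] --> (1 : R).
Proof.
move=> L0 foo k12 cg.
pose D nu := \sum_(k | k != k2) f k nu ^+ L k.
pose S nu := \sum_(k in dominant L f k2) f k nu ^+ L k.
have f_gt0 : \forall nu \near +oo, forall k, 0 < f k nu.
  by apply: filter_forall => k; have /cvgryPgt := foo k; apply.
have D_gt0 : \forall nu \near +oo, 0 < D nu.
  near=> nu.
  have fnu k : 0 < f k nu by move: k; near: nu.
  rewrite /D (bigD1 k1)//= ltr_pwDl ?exprn_gt0//.
  by apply: sumr_ge0 => k _; rewrite exprn_ge0// ltW.
have SD : S nu / D nu @[nu --> +oo] --> (1 : R).
  have -> : 1 = \sum_(k in dominant L f k2) gamma_lim L f k2 k :> R.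
    rewrite -(sum_gamma_lim foo k12 cg) (bigID (fun k => 0 < gamma_lim L f k2 k)).
    rewrite /= [X in _ + X]big1 ?addr0; last first.
      move=> k /andP[kk2]; rewrite -leNgt => le0; apply/eqP.
      by rewrite eq_le le0; apply: gamma_lim_ge0 => //; exact: cg.
    by apply: eq_bigl => k; rewrite inE.
  under eq_fun do rewrite /S mulr_suml.
  by apply: cvg_bigsum => k; rewrite inE => /andP[kk2 _]; exact: cg.
have WD : outer_weight L (f^~ nu) k2 / D nu @[nu --> +oo] --> (1 : R).
  (* The weight 1 of the centre, divided by [D], is the inverse of [f k1 nu ^+ L k1] times the share
     of [k1], which makes it vanish. *)
  have lim1 : (f k1 nu ^+ 0 / f k1 nu ^+ L k1) * branch_share L f k2 k1 nu +
      \sum_(k | k != k2) (\sum_(1 <= j < (L k).+1) bin_weight (L k) (f k nu) j)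
        / f k nu ^+ L k * branch_share L f k2 k nu @[nu --> +oo] -->
      (0 == L k1)%:R * gamma_lim L f k2 k1 +
      \sum_(k | k != k2) 1 * gamma_lim L f k2 k.
    apply: cvgD.
      by apply: cvgM; [exact: cvg_exprn_ratio|exact: cg].
    apply: cvg_bigsum => k kk2.
    by apply: cvgM; [exact: cvg_bin_weight_sum|exact: cg].
  rewrite (ltn_eqF (L0 _)) mul0r add0r -mulr_sumr mul1r (sum_gamma_lim foo k12 cg) in lim1.
  apply: cvg_trans lim1; apply: near_eq_cvg; near=> nu.
  have fnu k : f k nu ^+ L k != 0.
    by rewrite expf_neq0// gt_eqF//; move: k; near: nu.
  rewrite /outer_weight mulrDl mulr_suml expr0 !mul1r /branch_share -/(D nu).
  congr (_ + _); first by rewrite mulKf.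
  by apply: eq_bigr => k _; rewrite mulrA divfK.
(* Positivity of [S], and with it the existence of a dominant branch, is read off the limit 1 of
   [S / D]. *)
have S_gt0 : \forall nu \near +oo, 0 < S nu.
  have SD0 : \forall nu \near +oo, 0 < S nu / D nu by exact: (cvgr_gt _ SD).
  near=> nu; have Dnu : 0 < D nu by near: nu.
  by rewrite -(pmulr_lgt0 (S nu) (_ : 0 < (D nu)^-1)) ?invr_gt0//; near: nu.
split => //.
have lim1 : (outer_weight L (f^~ nu) k2 / D nu) * (S nu / D nu)^-1
    @[nu --> +oo] --> 1 * (1 : R)^-1.
  by apply: cvgM => //; apply: cvgV => //; exact: oner_neq0.
rewrite invr1 mulr1 in lim1.
apply: cvg_trans lim1; apply: near_eq_cvg; near=> nu.
have Dnu : 0 < D nu by near: nu.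
have Snu : 0 < S nu by near: nu.
by rewrite -/(S nu) /=; field; rewrite !gt_eqF.
Unshelve. all: by end_near. Qed.

(** Grouped to match the two terms of the asymptotic formula: the last sum carries the outer weight
    and answers to the second term. *)
Lemma mean_timeE (R : realType) (K : nat) (L : 'I_K -> nat) (a : 'I_K -> R)
    (k1 k2 : 'I_K) (m l : nat) : k1 != k2 ->
  mean_time L a k2 m k1 l =
  (\sum_(1 <= i < l.+1) down_time (L k1) (a k1) i +
   \sum_(0 <= i < m) up_time 0 (L k2) (a k2) i) +
  \sum_(0 <= i < m) outer_weight L a k2 /
    ((L k2 - i)%:R * a k2 * bin_weight (L k2) (a k2) i).
Proof.
move=> k12; rewrite /mean_time (negbTE k12) addrC -addrA; congr (_ + _).
by rewrite addrC -big_split; apply: eq_bigr => i _; rewrite up_timeD.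
Qed.

Lemma equivalent_mean_time (R : realType) (K : nat) (L : 'I_K -> nat)
    (f : 'I_K -> R -> R) (k1 k2 : 'I_K) (l1 : 'I_(L k1)) (l2 : 'I_(L k2)) :
  (forall k, (0 < L k)%N) ->
  (forall k, f k nu @[nu --> +oo] --> +oo) -> k1 != k2 ->
  (forall k, k != k2 -> cvg (branch_share L f k2 k nu @[nu --> +oo])) ->
  mean_time L (f^~ nu) k2 l2.+1 k1 l1.+1 /
    ((L k1)%:R^-1 * f k1 nu ^+ (L k1).-1 +
     ((L k2)%:R * f k2 nu)^-1 * \sum_(k in dominant L f k2) f k nu ^+ L k)
    @[nu --> +oo] --> (1 : R).
Proof.
move=> L0 foo k12 cg.
have [S_gt0 WS] := cvg_outer_weight_dominant L0 foo k12 cg.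
have f_gt0 k : \forall nu \near +oo, 0 < f k nu.
  by have /cvgryPgt := foo k; apply.
under eq_fun do rewrite mean_timeE//.
apply: cvg_add_ratio.
- near=> nu; rewrite mulr_gt0 ?invr_gt0 ?ltr0n ?exprn_gt0//.
  by near: nu; exact: f_gt0.
- near=> nu; rewrite mulr_gt0 ?invr_gt0 ?mulr_gt0 ?ltr0n//.
    by near: nu; exact: f_gt0.
  by near: nu.
(* When [L k1 = 1] the first denominator stays constant, so the inner upward times are treated as a
   factor tending to 0 times a factor with a finite limit. *)
- rewrite [X in _ --> X](_ : _ = \sum_(1 <= i < l1.+2) (i == 1)%:R +
      (\sum_(0 <= i < l2.+1) 0) * ((L k1)%:R * (0 == (L k1).-1)%:R)); last first.
    rewrite [X in _ + X * _]big1// mul0r addr0 big_ltn// big_nat big1 ?addr0//.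
    by move=> i /andP[i1 _]; rewrite gtn_eqF.
  under eq_fun do rewrite mulrDl mulr_suml.
  apply: cvgD.
    rewrite big_seq; under eq_fun do rewrite big_seq.
    apply: cvg_bigsum => i; rewrite mem_index_iota => /andP[i1 il].
    by apply: cvg_down_time => //; have := ltn_ord l1; lia.
  apply: cvgM.
    rewrite big_seq; under eq_fun do rewrite big_seq.
    apply: cvg_bigsum => i; rewrite mem_index_iota => /andP[_ il].
    by apply: cvg_inner_up_time => //; have := ltn_ord l2; lia.
  rewrite (_ : (fun nu => _) =
      fun nu => (L k1)%:R * (f k1 nu ^+ 0 / f k1 nu ^+ (L k1).-1)).
    by apply: cvgMl_tmp; exact: cvg_exprn_ratio.
  by apply/funext => nu; rewrite expr0 mul1r invfM invrK.
(* [c i] collects the constants. The accompanying power of [f k2] tends to 0 unless [i = 0], which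
   leaves the edge from the centre to level 1, with [c 0 = 1]. *)
pose c i : R := (L k2)%:R / ((L k2 - i)%:R * 'C(L k2, i)%:R).
have lim1 : \sum_(0 <= i < l2.+1) outer_weight L (f^~ nu) k2 /
     (\sum_(k in dominant L f k2) f k nu ^+ L k) *
    (c i * (f k2 nu ^+ 1 / f k2 nu ^+ i.+1)) @[nu --> +oo] -->
    \sum_(0 <= i < l2.+1) 1 * (c i * ((1 == i.+1)%:R : R)).
  apply: cvg_bigsum => i _.
  by apply: cvgM => //; apply: cvgMl_tmp; exact: cvg_exprn_ratio.
rewrite big_ltn// big_nat big1 in lim1; last first.
  by move=> i /andP[i1 _]; rewrite eqSS ltn_eqF// !mulr0.
rewrite /c subn0 bin0 !mulr1 mulfV ?mul1r ?addr0 in lim1; last first.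
  by rewrite pnatr_eq0 -lt0n.
apply: cvg_trans lim1; apply: near_eq_cvg; near=> nu.
have fnu : f k2 nu != 0 by rewrite gt_eqF//; near: nu; exact: f_gt0.
have Snu : \sum_(k in dominant L f k2) f k nu ^+ L k != 0.
  by rewrite gt_eqF//; near: nu.
rewrite mulr_suml big_seq [RHS]big_seq; apply: eq_bigr => i.
rewrite mem_index_iota => /andP[_ il].
rewrite /bin_weight [f k2 nu ^+ i.+1]exprS expr1; field.
rewrite Snu fnu expf_neq0//= !pnatr_eq0 -!lt0n bin_gt0 subn_gt0 L0.
by have := ltn_ord l2; lia.
Unshelve. all: by end_near. Qed.

Theorem theorem3p1 (R : realType) (K : nat) (K_gt0 : (0 < K)%N)
    (L : 'I_K -> nat) (L_gt0 : forall k, (0 < L k)%N)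
    (f : 'I_K -> R -> R)
    (f_ge0 : forall k (nu : R), 0 <= nu -> 0 <= f k nu)
    (f_monotone : forall k, monotone_nneg (f k))
    (f_pinfty : forall k, f k nu @[nu --> +oo] --> +oo)
    (k1 k2 : 'I_K) (k12 : k1 != k2)
    (l1 : 'I_(L k1)) (l2 : 'I_(L k2))
    (gamma_cvg : forall k, k != k2 ->
      cvg (branch_share L f k2 k nu @[nu --> +oo]))
    (d : measure_display) (T : R -> measurableType d)
    (P : forall nu, probability (T nu) R)
    (X : forall nu, R -> T nu -> star_state L)
    (X_markov : forall nu : R, 0 <= nu ->
      markov_process (star_rate (fun k => f k nu)) (star_node l1)
        (P nu) (X nu)) :
  equivalent_at_infinity
    (fun nu => (\int[P nu]_w transition_time (X nu) (star_node l2) w)%E)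
    (fun nu =>
       (L k1)%:R^-1 * f k1 nu ^+ (L k1).-1 +
       ((L k2)%:R * f k2 nu)^-1 *
         \sum_(k in dominant L f k2) f k nu ^+ L k).
Proof.
have f_gt0 : \forall nu \near +oo, forall k, 0 < f k nu.
  by apply: filter_forall => k; have /cvgryPgt := f_pinfty k; apply.
have lim1 := equivalent_mean_time l1 l2 L_gt0 f_pinfty k12 gamma_cvg.
pose g nu := (mean_time L (f^~ nu) k2 l2.+1 k1 l1.+1 /
  ((L k1)%:R^-1 * f k1 nu ^+ (L k1).-1 + ((L k2)%:R * f k2 nu)^-1 *
   \sum_(k in dominant L f k2) f k nu ^+ L k))%:E.
(* For large [nu] all rates are positive and the integral is exactly [mean_time], so the two
   functions agree near [+oo]. *)
apply: (@cvg_trans _ (g nu @[nu --> +oo])); last first.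
  by apply: cvg_EFin; [exact: nearW|exact: lim1].
apply: near_eq_cvg; near=> nu.
have nu0 : 0 <= nu by near: nu; exact: nbhs_pinfty_ge.
have fnu k : 0 < f k nu by move: k; near: nu.
by rewrite /g EFinM (expected_star_transition_time l2 L_gt0 fnu k12 (X_markov nu nu0)).
Unshelve. all: by end_near. Qed.
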